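(* (1) If $L>-1/2$ and $\eta\in\mathbb{R}$, then the zeros of $\rho\mapsto F_L(\eta,\rho)$ and of $\rho\mapsto F_L'(\eta,\rho)$ are interlacing. (2) If $L>-1$ and $\eta\in\mathbb{R}$, then the zeros of $\rho\mapsto F_L(\eta,\rho)$ and of $\rho\mapsto \rho F_L'(\eta,\rho)-(L+1)F_L(\eta,\rho)$ are interlacing.
   Context: For real $L>-1$ and $\eta\in\mathbb{R}$, the regular Coulomb wave function is $$F_{L}(\eta,\rho)=C_{L}(\eta)\,\rho^{L+1}\mathcal{F}_L(\eta,\rho),\qquad \mathcal{F}_L(\eta,\rho)=e^{-\mathrm{i}\rho}\,{}_1F_1(L+1-\mathrm{i}\eta,2L+2;2\mathrm{i}\rho),\qquad C_L(\eta)=\frac{2^Le^{-\pi\eta/2}\left|\Gamma(L+1+\mathrm{i}\eta)\right|}{\Gamma(2L+2)},$$ where ${}_1F_1$ is the Kummer confluent hypergeometric function; $\mathcal{F}_L(\eta,\cdot)$ is entire and real on the real axis. Primes denote derivatives in $\rho$. Zeros are understood after removing the power of $\rho$: the zeros of $F_L(\eta,\cdot)$ are the zeros of $\mathcal{F}_L(\eta,\cdot)$; those of $F_L'(\eta,\cdot)$ are the zeros of the entire function $(L+1)\mathcal{F}_L(\eta,\rho)+\rho\mathcal{F}_L'(\eta,\rho)$; and, since $\rho F_L'-(L+1)F_L=C_L(\eta)\rho^{L+2}\mathcal{F}_L'$, those of $\rho F_L'(\eta,\rho)-(L+1)F_L(\eta,\rho)$ are the zeros of $\mathcal{F}_L'(\eta,\cdot)$.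 Two functions have interlacing zeros if between any two consecutive zeros of either one there is exactly one zero of the other. In (1) this is meant for the positive zeros and for the negative zeros separately (the origin separating the two families); in (2) it is meant for all zeros on the real line. *)

(* Defs.v *)
From Stdlib Require Import Reals Factorial.
From Coquelicot Require Import Coquelicot.

Open Scope R_scope.

Definition Cexp (z : C) : C := (exp (Re z) * cos (Im z), exp (Re z) * sin (Im z)).

Definition CSeries (u : nat -> C) : C :=
  (Series (fun n => Re (u n)), Series (fun n => Im (u n))).

Fixpoint Cpochhammer (a : C) (n : nat) : C :=
  match n with
  | O => RtoC 1
  | S m => (Cpochhammer a m * (a + RtoC (INR m)))%C
  end.

Definition kummer_1F1 (a b z : C) : C :=
  CSeries (fun n => (Cpochhammer a n / Cpochhammer b n * (z ^ n / RtoC (INR (fact n))))%C).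

(** The entire function in [F_L(eta,rho) = C_L(eta) rho^(L+1) coulombC L eta rho],
    where [C_L(eta) > 0]. *)
Definition coulombC (L eta : R) (z : C) : C :=
  (Cexp (- (Ci * z)) *
   kummer_1F1 (RtoC (L + 1) - Ci * RtoC eta) (RtoC (2 * L + 2)) (RtoC 2 * Ci * z))%C.

(** [coulombC L eta] is real on the real axis (Kummer's transformation), so that
    taking the real part discards nothing. *)
Definition coulomb (L eta rho : R) : R := Re (coulombC L eta (RtoC rho)).

(** The three functions below are [F_L], [F_L'] and [rho F_L' - (L+1) F_L] divided by
    [C_L(eta) rho^(L+1)], [C_L(eta) rho^L] and [C_L(eta) rho^(L+2)] respectively.
    These quotients are defined on the whole real line, although the power of [rho] is
    not, and the zeros of the Coulomb functions are by convention those of the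
    quotients. *)
Definition coulomb_F (L eta rho : R) : R := coulomb L eta rho.

Definition coulomb_dF (L eta rho : R) : R :=
  (L + 1) * coulomb L eta rho + rho * Derive (coulomb L eta) rho.

Definition coulomb_rdF (L eta rho : R) : R := Derive (coulomb L eta) rho.

Definition zero_in (D : R -> Prop) (f : R -> R) (x : R) : Prop := D x /\ f x = 0.

Definition consecutive (Z : R -> Prop) (a b : R) : Prop :=
  a < b /\ Z a /\ Z b /\ forall x, a < x < b -> ~ Z x.

Definition one_between (Z W : R -> Prop) : Prop :=
  forall a b, consecutive Z a b -> exists! x, a < x < b /\ W x.

Definition interlacing_zeros (D : R -> Prop) (f g : R -> R) : Prop :=
  one_between (zero_in D f) (zero_in D g) /\ one_between (zero_in D g) (zero_in D f).

(* Main.v *)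
Require Import Defs.
From Stdlib Require Import Reals Factorial Lra FunctionalExtensionality.
From Coquelicot Require Import Coquelicot.

Open Scope R_scope.

(** Write [f] for [coulomb L eta], so that [F_L] is a constant multiple of
    [x ^ (L + 1) f]. Everything follows from the differential equation
      [x f'' + 2 (L + 1) f' + (x - 2 eta) f = 0],  [f 0 = 1],
    without factorizing [f] over its zeros.

    The equation is read off the power series: on the imaginary axis the Kummer function
    is [A + i B] with [A], [B] real entire power series, [coulomb = cos x A + sin x B], and
    the recurrence of the Kummer coefficients is a linear differential system for [A], [B]
    ([coulomb_is_solution]).

    Interlacing is a Sturm argument ([interlacing_of_crossings]): the zeros of [u] and [v]
    interlace on an interval when [u' v > 0] at the zeros of [u] and [v' u < 0] at the zeros
    of [v], that is, when the curve [(u, v)] always crosses the axes clockwise. It is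
    applied to [u = f] and [v = f'], and, on each half-line, to [u = f] and [v = g] or
    [v = - g], where [g = (L + 1) f + x f']. Zeros of [f] are simple
    ([simple_zeros]), which gives the first condition.

    For the second one, the reflection [x -> - x], [eta -> - eta] reduces matters to
    [x >= 0]. At a zero of [f'] the equation gives [x f'' = - (x - 2 eta) f], of the right
    sign once [x > 2 eta]; when [eta > 0], [x ^ (2 L + 2) f'] increases as long as [f > 0]
    and [x < 2 eta], so that [f'] has no zero from [0] to [2 eta] inclusive
    ([no_oscillation]). At the origin itself [f' = 0] forces [eta = 0], and
    [(2 L + 3) f'' = - 1]. At a zero of [g] it gives
    [x g' = - (x ^ 2 - 2 eta x - L (L + 1)) f], and where the quadratic is nonpositive [g]
    cannot vanish: for [L >= 0] because [x ^ L g] increases there as long as [f > 0], for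
    [L < 0] because this can only happen below [2 eta], where [f] and [f'] are positive
    ([turning_point_lt_zero]). *)

(** * Sign changes of differentiable functions *)

Lemma continuity_locally_pos (h : R -> R) (x : R) :
  (forall y, continuity_pt h y) -> 0 < h x ->
  exists d, 0 < d /\ forall y, Rabs (y - x) < d -> 0 < h y.
Proof.
  intros hc hx.
  destruct (hc x (h x) hx) as [d [hd Hd]].
  exists d; split; [exact hd|].
  intros y hy.
  destruct (Req_dec y x) as [->|ne]; [exact hx|].
  assert (H : Rabs (h y - h x) < h x).
  { apply (Hd y); split; [split; [exact I | congruence] | exact hy]. }
  apply Rabs_def2 in H; lra.
Qed.

(** A function with derivative [l < 0] at one of its zeros is positive just to the left
    of it and negative just to the right. *)
Lemma is_derive_neg_sign_change (h : R -> R) (x l : R) :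
  is_derive h x l -> h x = 0 -> l < 0 ->
  exists d, 0 < d /\ forall y, Rabs (y - x) < d ->
    (y < x -> 0 < h y) /\ (x < y -> h y < 0).
Proof.
  intros hd hx hl.
  apply is_derive_Reals in hd.
  destruct (hd (- l)) as [[d hdpos] Hd]; [lra|].
  exists d; split; [exact hdpos|]; simpl in Hd.
  intros y hy.
  assert (K : y <> x -> (h y / (y - x)) < 0).
  { intros ne.
    specialize (Hd (y - x)).
    replace (x + (y - x)) with y in Hd by ring.
    rewrite hx, Rminus_0_r in Hd.
    assert (y - x <> 0) by lra.
    specialize (Hd ltac:(assumption) hy).
    apply Rabs_def2 in Hd; lra. }
  split; intros hlt.
  - specialize (K ltac:(lra)).
    replace (h y) with ((h y / (y - x)) * (y - x)) by (field; lra). nra.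
  - specialize (K ltac:(lra)).
    replace (h y) with ((h y / (y - x)) * (y - x)) by (field; lra). nra.
Qed.

Lemma first_zero (h : R -> R) (a b : R) :
  (forall y, continuity_pt h y) -> a <= b -> 0 < h a -> h b <= 0 ->
  exists s, a < s <= b /\ h s = 0 /\ forall y, a <= y < s -> 0 < h y.
Proof.
  intros hc hab ha hb.
  set (E := fun x => a <= x <= b /\ forall y, a <= y <= x -> 0 < h y).
  destruct (completeness E) as [s [hub hlub]].
  { exists b; intros x [Hx _]; lra. }
  { exists a; split; [lra|]; intros y hy; replace y with a by lra; exact ha. }
  assert (has : a <= s).
  { apply hub; split; [lra|]; intros y hy; replace y with a by lra; exact ha. }
  assert (hsb : s <= b) by (apply hlub; intros x [Hx _]; lra).
  assert (hpos : forall y, a <= y < s -> 0 < h y).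
  { intros y hy.
    destruct (Rlt_le_dec 0 (h y)) as [H|H]; [exact H|].
    exfalso.
    assert (s <= y); [|lra].
    apply hlub; intros x [Hx Hx'].
    destruct (Rle_lt_dec x y) as [H1|H1]; [exact H1|].
    specialize (Hx' y); lra. }
  assert (hs0 : h s = 0).
  { destruct (Rtotal_order (h s) 0) as [H|[H|H]]; [|exact H|]; exfalso.
    - destruct (continuity_locally_pos (fun x => - h x) s) as [d [hd Hd]].
      { intros y; apply continuity_pt_opp, hc. }
      { lra. }
      assert (a < s) by (destruct (Req_dec a s); [subst; lra | lra]).
      assert (0 < Rmin d (s - a)) by (apply Rmin_pos; lra).
      pose proof (Rmin_l d (s - a)); pose proof (Rmin_r d (s - a)).
      specialize (Hd (s - Rmin d (s - a) / 2)).
      specialize (hpos (s - Rmin d (s - a) / 2)).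
      rewrite Rabs_left in Hd; lra.
    - destruct (continuity_locally_pos h s hc H) as [d [hd Hd]].
      assert (s < b) by (destruct (Req_dec s b); [subst; lra | lra]).
      assert (0 < Rmin d (b - s)) by (apply Rmin_pos; lra).
      pose proof (Rmin_l d (b - s)); pose proof (Rmin_r d (b - s)).
      assert (s + Rmin d (b - s) / 2 <= s); [|lra].
      apply hub; split; [lra|]; intros y hy.
      destruct (Rlt_le_dec y s); [apply hpos; lra|].
      apply Hd; rewrite Rabs_pos_eq; lra. }
  exists s; split; [|split; assumption].
  split; [|exact hsb].
  destruct (Req_dec a s); [subst; lra | lra].
Qed.

(** A function all of whose zeros in an interval are strictly decreasing crossings has at
    most one zero there. *)
Lemma no_two_decreasing_zeros (v dv : R -> R) (c d : R) :
  (forall y, is_derive v y (dv y)) -> c < d -> v c = 0 -> v d = 0 ->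
  (forall y, c <= y <= d -> v y = 0 -> dv y < 0) -> False.
Proof.
  intros hv hcd hc hd hneg.
  destruct (is_derive_neg_sign_change v c (dv c)) as [r [hr Hr]]; auto.
  { apply hneg; lra. }
  assert (0 < Rmin r (d - c)) by (apply Rmin_pos; lra).
  pose proof (Rmin_l r (d - c)); pose proof (Rmin_r r (d - c)).
  set (a := c + Rmin r (d - c) / 2).
  destruct (first_zero (fun y => - v y) a d) as [s [hs [hs0 hspos]]].
  { intros y; apply continuity_pt_opp, derivable_continuous_pt.
    exists (dv y); apply is_derive_Reals, hv. }
  { unfold a; lra. }
  { destruct (Hr a) as [_ K].
    - unfold a; rewrite Rabs_pos_eq; lra.
    - specialize (K ltac:(unfold a; lra)); lra. }
  { lra. }
  (* the next zero [s] is approached from below, hence not a decreasing crossing *)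
  destruct (is_derive_neg_sign_change v s (dv s)) as [r' [hr' Hr']]; auto.
  { lra. }
  { apply hneg; unfold a in hs; lra. }
  assert (0 < Rmin r' (s - a)) by (apply Rmin_pos; lra).
  pose proof (Rmin_l r' (s - a)); pose proof (Rmin_r r' (s - a)).
  destruct (Hr' (s - Rmin r' (s - a) / 2)) as [K _].
  { rewrite Rabs_left; lra. }
  specialize (K ltac:(lra)).
  specialize (hspos (s - Rmin r' (s - a) / 2)); simpl in hspos; lra.
Qed.

(** * Sturm-type interlacing criterion *)

Lemma continuity_pt_of_derive (h dh : R -> R) :
  (forall y, is_derive h y (dh y)) -> forall y, continuity_pt h y.
Proof.
  intros hh y; apply derivable_continuous_pt.
  exists (dh y); apply is_derive_Reals, hh.
Qed.

Lemma no_zero_constant_sign (h : R -> R) (a b : R) :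
  (forall y, continuity_pt h y) -> (forall y, a < y < b -> h y <> 0) ->
  (forall y, a < y < b -> 0 < h y) \/ (forall y, a < y < b -> h y < 0).
Proof.
  intros hc hne.
  destruct (Rlt_le_dec a b) as [hab|hab]; [|left; intros; lra].
  set (m := (a + b) / 2).
  assert (hm : a < m < b) by (unfold m; lra).
  assert (gen : forall k : R -> R, (forall y, continuity_pt k y) ->
            (forall y, a < y < b -> k y <> 0) -> 0 < k m ->
            forall y, a < y < b -> 0 < k y).
  { intros k kc kne km y hy.
    destruct (Rlt_le_dec 0 (k y)) as [H|H]; [exact H|exfalso].
    destruct (Rle_lt_dec m y) as [H1|H1].
    - destruct (first_zero k m y) as [s [hs [hs0 _]]]; auto.
      apply (kne s); auto; lra.
    - destruct (first_zero (fun x => - k x) y m) as [s [hs [hs0 _]]]; try lra.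
      { intros x; apply continuity_pt_opp, kc. }
      { specialize (kne y hy); lra. }
      apply (kne s); lra. }
  destruct (Rtotal_order (h m) 0) as [H|[H|H]].
  - right; intros y hy.
    enough (0 < - h y) by lra.
    apply (gen (fun x => - h x)); auto; try lra.
    { intros x; apply continuity_pt_opp, hc. }
    intros x hx; specialize (hne x hx); lra.
  - exfalso; apply (hne m); auto.
  - left; apply gen; auto.
Qed.

Lemma one_between_pos (D : R -> Prop) (u v du dv : R -> R) (a b : R) :
  (forall x y z, D x -> D z -> x <= y <= z -> D y) ->
  (forall y, is_derive u y (du y)) -> (forall y, is_derive v y (dv y)) ->
  (forall y, D y -> u y = 0 -> 0 < du y * v y) ->
  (forall y, D y -> v y = 0 -> dv y * u y < 0) ->
  a < b -> D a -> D b -> u a = 0 -> u b = 0 -> (forall y, a < y < b -> 0 < u y) ->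
  exists! x, a < x < b /\ zero_in D v x.
Proof.
  intros hD hu hv hzu hzv hab Da Db ua ub upos.
  assert (Dab : forall y, a <= y <= b -> D y) by (intros y hy; apply (hD a y b); auto).
  assert (va : 0 < v a).
  { pose proof (hzu a Da ua) as P.
    destruct (Rlt_le_dec 0 (du a)) as [H|H]; [nra|exfalso].
    destruct (is_derive_neg_sign_change u a (du a)) as [r [hr Hr]]; auto.
    { destruct (Req_dec (du a) 0) as [e|e]; [rewrite e in P; lra | lra]. }
    assert (0 < Rmin r (b - a)) by (apply Rmin_pos; lra).
    pose proof (Rmin_l r (b - a)); pose proof (Rmin_r r (b - a)).
    destruct (Hr (a + Rmin r (b - a) / 2)) as [_ K].
    { rewrite Rabs_pos_eq; lra. }
    specialize (K ltac:(lra)); specialize (upos (a + Rmin r (b - a) / 2)); lra. }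
  assert (vb : v b < 0).
  { pose proof (hzu b Db ub) as P.
    destruct (Rlt_le_dec (du b) 0) as [H|H]; [nra|exfalso].
    destruct (is_derive_neg_sign_change (fun x => - u x) b (- du b)) as [r [hr Hr]].
    { exact (is_derive_opp u b (du b) (hu b)). }
    { lra. }
    { destruct (Req_dec (du b) 0) as [e|e]; [rewrite e in P; lra | lra]. }
    assert (0 < Rmin r (b - a)) by (apply Rmin_pos; lra).
    pose proof (Rmin_l r (b - a)); pose proof (Rmin_r r (b - a)).
    destruct (Hr (b - Rmin r (b - a) / 2)) as [K _].
    { rewrite Rabs_left; lra. }
    specialize (K ltac:(lra)); specialize (upos (b - Rmin r (b - a) / 2)); lra. }
  destruct (first_zero v a b) as [s [hs [hs0 _]]]; try lra.
  { apply (continuity_pt_of_derive v dv hv). }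
  assert (s <> b) by (intros ->; lra).
  exists s; split.
  { split; [lra|]; split; [apply Dab; lra | exact hs0]. }
  assert (uniq : forall c d, a < c -> d < b -> c < d -> v c = 0 -> v d = 0 -> False).
  { intros c d hac hdb hcd vc vd.
    apply (no_two_decreasing_zeros v dv c d); auto.
    intros y hy vy.
    pose proof (hzv y (Dab y ltac:(lra)) vy); pose proof (upos y ltac:(lra)); nra. }
  intros t [ht [_ vt]].
  destruct (Rtotal_order s t) as [H1|[H1|H1]]; [exfalso|exact H1|exfalso].
  - apply (uniq s t); auto; lra.
  - apply (uniq t s); auto; lra.
Qed.

Lemma one_between_of_crossings (D : R -> Prop) (u v du dv : R -> R) :
  (forall x y z, D x -> D z -> x <= y <= z -> D y) ->
  (forall y, is_derive u y (du y)) -> (forall y, is_derive v y (dv y)) ->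
  (forall y, D y -> u y = 0 -> 0 < du y * v y) ->
  (forall y, D y -> v y = 0 -> dv y * u y < 0) ->
  one_between (zero_in D u) (zero_in D v).
Proof.
  intros hD hu hv hzu hzv a b [hab [[Da ua] [[Db ub] hno]]].
  assert (une : forall y, a < y < b -> u y <> 0).
  { intros y hy e; apply (hno y hy); split; [apply (hD a y b); auto; lra | exact e]. }
  destruct (no_zero_constant_sign u a b) as [P|P]; auto.
  { apply (continuity_pt_of_derive u du hu). }
  - apply (one_between_pos D u v du dv); auto.
  - destruct (one_between_pos D (fun x => - u x) (fun x => - v x)
                (fun x => - du x) (fun x => - dv x) a b) as [s [[hs [Ds vs]] huniq]];
      auto; try lra.
    { intros y; exact (is_derive_opp u y (du y) (hu y)). }
    { intros y; exact (is_derive_opp v y (dv y) (hv y)). }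
    { intros y Dy e; assert (e' : u y = 0) by lra.
      pose proof (hzu y Dy e'); lra. }
    { intros y Dy e; assert (e' : v y = 0) by lra.
      pose proof (hzv y Dy e'); lra. }
    { intros y hy; specialize (P y hy); lra. }
    exists s; split.
    { split; [exact hs|]; split; [exact Ds | lra]. }
    intros t [ht [Dt vt]]; apply huniq.
    split; [exact ht|]; split; [exact Dt | lra].
Qed.

(** Sturm's criterion: when [u] crosses each of its zeros in the direction of the sign of
    [v], and [v] crosses each of its zeros in the direction of the sign of [- u] (so that
    the plane curve [(u, v)] always crosses the axes clockwise), the zeros interlace. *)
Lemma interlacing_of_crossings (D : R -> Prop) (u v du dv : R -> R) :
  (forall x y z, D x -> D z -> x <= y <= z -> D y) ->
  (forall y, is_derive u y (du y)) -> (forall y, is_derive v y (dv y)) ->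
  (forall y, D y -> u y = 0 -> 0 < du y * v y) ->
  (forall y, D y -> v y = 0 -> dv y * u y < 0) ->
  interlacing_zeros D u v.
Proof.
  intros hD hu hv hzu hzv; split.
  { apply (one_between_of_crossings D u v du dv); auto. }
  (* the pair [(v, - u)] satisfies the same crossing conditions *)
  assert (H : one_between (zero_in D v) (zero_in D (fun x => - u x))).
  { apply (one_between_of_crossings D v (fun x => - u x) dv (fun x => - du x)); auto.
    - intros y; exact (is_derive_opp u y (du y) (hu y)).
    - intros y Dy e; pose proof (hzv y Dy e); lra.
    - intros y Dy e; assert (e' : u y = 0) by lra.
      pose proof (hzu y Dy e'); lra. }
  intros a b hab.
  destruct (H a b hab) as [s [[hs [Ds us]] huniq]].
  exists s; split.
  { split; [exact hs|]; split; [exact Ds | lra]. }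
  intros t [ht [Dt ut]]; apply huniq.
  split; [exact ht|]; split; [exact Dt | lra].
Qed.

(** * The Coulomb equation on the half-line *)

(** [f], with first and second derivatives [f1] and [f2], is the solution regular at the
    origin, normalized by [f 0 = 1], of [x f'' + 2 (L + 1) f' + (x - 2 eta) f = 0]. The
    equation is singular at [0], where it says nothing about [f'']; the last field is the
    relation obtained by differentiating it once there. *)
Record coulomb_solution (L eta : R) (f f1 f2 : R -> R) : Prop := {
  cs_der1 : forall x, is_derive f x (f1 x);
  cs_der2 : forall x, is_derive f1 x (f2 x);
  cs_init : f 0 = 1;
  cs_ode : forall x, x * f2 x + 2 * (L + 1) * f1 x + (x - 2 * eta) * f x = 0;
  cs_ode0 : (2 * L + 3) * f2 0 = 2 * eta * f1 0 - f 0
}.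

Lemma coulomb_solution_reflect (L eta : R) (f f1 f2 : R -> R) :
  coulomb_solution L eta f f1 f2 ->
  coulomb_solution L (- eta) (fun x => f (- x)) (fun x => - f1 (- x)) (fun x => f2 (- x)).
Proof.
  intros [h1 h2 h0 ho ho0]; split.
  - intros x; auto_derive.
    + exists (f1 (- x)); apply h1.
    + erewrite is_derive_unique by apply h1; ring.
  - intros x; auto_derive.
    + exists (f2 (- x)); apply h2.
    + erewrite is_derive_unique by apply h2; ring.
  - now rewrite Ropp_0.
  - intros x; specialize (ho (- x)); lra.
  - rewrite Ropp_0; lra.
Qed.

(** If [x h' + K h >= 0] for [a <= x <= b] then [x ^ K h] is nondecreasing there; the power
    is written with [exp] and [ln], [K] being real. *)
Lemma weighted_nondecreasing (h dh : R -> R) (K a b : R) :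
  0 < a -> a <= b -> (forall x, is_derive h x (dh x)) ->
  (forall x, a <= x <= b -> 0 <= x * dh x + K * h x) ->
  exp (K * ln a) * h a <= exp (K * ln b) * h b.
Proof.
  intros ha hab hd hK.
  destruct (MVT_gen (fun x => exp (K * ln x) * h x) a b
              (fun x => exp (K * ln x) * (dh x + K / x * h x))) as [c [hc e]].
  - rewrite Rmin_left, Rmax_right by lra.
    intros x hx; auto_derive.
    + repeat split; [lra | exists (dh x); apply hd].
    + erewrite is_derive_unique by apply hd; field; lra.
  - rewrite Rmin_left, Rmax_right by lra.
    intros x hx; apply continuity_pt_filterlim.
    apply (ex_derive_continuous (fun x => exp (K * ln x) * h x)).
    auto_derive; repeat split; [lra | exists (dh x); apply hd].
  - rewrite Rmin_left, Rmax_right in hc by lra.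
    specialize (hK c hc).
    pose proof (exp_pos (K * ln c)).
    assert (0 <= dh c + K / c * h c).
    { replace (dh c + K / c * h c) with ((c * dh c + K * h c) / c) by (field; lra).
      apply Rdiv_le_0_compat; lra. }
    assert (0 <= exp (K * ln c) * (dh c + K / c * h c) * (b - a)).
    { apply Rmult_le_pos; [apply Rmult_le_pos|]; lra. }
    lra.
Qed.

Lemma weighted_stays_pos (h dh : R -> R) (K a b : R) :
  0 < a -> a <= b -> (forall x, is_derive h x (dh x)) ->
  (forall x, a <= x <= b -> 0 <= x * dh x + K * h x) -> 0 < h a -> 0 < h b.
Proof.
  intros ha hab hd hK hpos.
  pose proof (weighted_nondecreasing h dh K a b ha hab hd hK).
  pose proof (exp_pos (K * ln a)); pose proof (exp_pos (K * ln b)).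
  assert (0 < exp (K * ln a) * h a) by (apply Rmult_lt_0_compat; lra).
  apply (Rmult_lt_reg_l (exp (K * ln b))); lra.
Qed.

Lemma weighted_pos_of_pos_at_0 (h dh : R -> R) (K b : R) :
  0 < b -> (forall x, is_derive h x (dh x)) ->
  (forall x, 0 < x <= b -> 0 <= x * dh x + K * h x) -> 0 < h 0 ->
  forall x, 0 <= x <= b -> 0 < h x.
Proof.
  intros hb hd hK h0 x hx.
  destruct (Req_dec x 0) as [->|ne]; [exact h0|].
  destruct (continuity_locally_pos h 0 (continuity_pt_of_derive h dh hd) h0)
    as [d [hdp Hd]].
  assert (0 < Rmin d x) by (apply Rmin_pos; lra).
  pose proof (Rmin_l d x); pose proof (Rmin_r d x).
  apply (weighted_stays_pos h dh K (Rmin d x / 2) x); try lra; auto.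
  - intros y hy; apply hK; lra.
  - apply Hd; rewrite Rminus_0_r, Rabs_pos_eq; lra.
Qed.

(** The derivative of [x ^ (L + 1) f] divided by [x ^ L], and its derivative; [f1] and [f2]
    stand for [f'] and [f'']. *)
Definition reduced_derivative (L : R) (f f1 : R -> R) (x : R) : R :=
  (L + 1) * f x + x * f1 x.
Definition reduced_derivative2 (L : R) (f1 f2 : R -> R) (x : R) : R :=
  (L + 2) * f1 x + x * f2 x.

Section HalfLine.

Context (L eta : R) (f f1 f2 : R -> R).
Context (hL : -1 < L) (hf : coulomb_solution L eta f f1 f2).

Let h1 := cs_der1 _ _ _ _ _ hf.
Let h2 := cs_der2 _ _ _ _ _ hf.
Let h0 := cs_init _ _ _ _ _ hf.
Let ho := cs_ode _ _ _ _ _ hf.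

(** Uniqueness for the Cauchy problem away from the origin: the energy
    [E = f ^ 2 + f' ^ 2] satisfies [x E' + K E >= 0] for large [K], so that it vanishes
    between the origin and any of its positive zeros, contradicting [f 0 = 1]. *)
Lemma simple_zeros_pos (x : R) : 0 < x -> f x = 0 -> f1 x = 0 -> False.
Proof.
  intros hx fx f1x.
  set (E := fun x => f x * f x + f1 x * f1 x).
  set (dE := fun x => 2 * f x * f1 x + 2 * f1 x * f2 x).
  assert (hE : forall x, is_derive E x (dE x)).
  { intros y; unfold E, dE; auto_derive.
    - repeat split; try (exists (f1 y); apply h1); exists (f2 y); apply h2.
    - erewrite !is_derive_unique by (apply h1 || apply h2); ring. }
  set (K := 2 * Rabs eta + 4 * (L + 1)).
  assert (hlow : forall a, 0 < a -> a <= x -> f a = 0).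
  { intros a ha hax.
    assert (W : exp (K * ln a) * E a <= exp (K * ln x) * E x).
    { apply weighted_nondecreasing with dE; auto.
      intros y hy.
      pose proof (ho y) as oy.
      replace (y * dE y + K * E y)
        with (4 * eta * f y * f1 y + 2 * Rabs eta * (f y * f y + f1 y * f1 y)
              + 4 * (L + 1) * (f y * f y)
              + 2 * f1 y * (y * f2 y + 2 * (L + 1) * f1 y + (y - 2 * eta) * f y))
        by (unfold dE, E, K; ring).
      rewrite oy.
      assert (0 <= 4 * eta * f y * f1 y + 2 * Rabs eta * (f y * f y + f1 y * f1 y)).
      { pose proof (Rle_0_sqr (f y + f1 y)) as S1.
        pose proof (Rle_0_sqr (f y - f1 y)) as S2; unfold Rsqr in S1, S2.
        destruct (Rle_lt_dec 0 eta).
        - rewrite Rabs_pos_eq by lra; nra.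
        - rewrite Rabs_left by lra; nra. }
      pose proof (Rle_0_sqr (f y)) as S; unfold Rsqr in S; nra. }
    assert (Ex : E x = 0) by (unfold E; rewrite fx, f1x; ring).
    rewrite Ex in W.
    pose proof (exp_pos (K * ln a)).
    assert (E a <= 0) by nra.
    pose proof (Rle_0_sqr (f a)) as S1; pose proof (Rle_0_sqr (f1 a)) as S2.
    unfold Rsqr, E in *; nra. }
  destruct (continuity_locally_pos f 0) as [d [hd Hd]].
  { apply (continuity_pt_of_derive f f1 h1). }
  { lra. }
  assert (0 < Rmin d x) by (apply Rmin_pos; lra).
  pose proof (Rmin_l d x); pose proof (Rmin_r d x).
  specialize (Hd (Rmin d x / 2)); specialize (hlow (Rmin d x / 2)).
  rewrite Rminus_0_r, Rabs_pos_eq in Hd; lra.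
Qed.

Lemma f1_at_0 : (L + 1) * f1 0 = eta.
Proof. specialize (ho 0); rewrite h0 in ho; lra. Qed.

(** For [eta > 0], up to the point [2 eta] where the sign of the potential term changes,
    [f] and [f'] stay positive. *)
Lemma no_oscillation (b : R) :
  0 < b -> b <= 2 * eta -> forall x, 0 <= x <= b -> 0 < f x /\ 0 < f1 x.
Proof.
  intros hb hbe.
  assert (f10 : 0 < f1 0) by (pose proof f1_at_0; nra).
  assert (mono : forall c, 0 < c <= b -> (forall y, 0 < y < c -> 0 < f y) ->
            forall x, 0 <= x <= c -> 0 < f1 x).
  { intros c hc fpos.
    apply (weighted_pos_of_pos_at_0 f1 f2 (2 * (L + 1))); auto; try lra.
    intros y hy.
    assert (0 <= f y).
    { destruct (Req_dec y c) as [->|ne]; [|specialize (fpos y); lra].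
      destruct (Rle_lt_dec 0 (f c)) as [H|H]; [exact H|exfalso].
      destruct (continuity_locally_pos (fun x => - f x) c) as [d [hd Hd]]; try lra.
      { intros z; apply continuity_pt_opp, (continuity_pt_of_derive f f1 h1). }
      assert (0 < Rmin d c) by (apply Rmin_pos; lra).
      pose proof (Rmin_l d c); pose proof (Rmin_r d c).
      specialize (Hd (c - Rmin d c / 2)); specialize (fpos (c - Rmin d c / 2)).
      rewrite Rabs_left in Hd; lra. }
    pose proof (ho y); nra. }
  assert (fpos : forall x, 0 <= x <= b -> 0 < f x).
  { intros x hx.
    destruct (Rlt_le_dec 0 (f x)) as [H|H]; [exact H|exfalso].
    destruct (first_zero f 0 x) as [s [hs [fs spos]]]; try lra.
    { apply (continuity_pt_of_derive f f1 h1). }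
    destruct (MVT_gen f 0 s f1) as [c [hc e]].
    { intros; apply h1. }
    { intros; apply (continuity_pt_of_derive f f1 h1). }
    rewrite Rmin_left, Rmax_right in hc by lra.
    assert (0 < f1 c).
    { apply (mono s); try lra; intros y hy; apply spos; lra. }
    nra. }
  intros x hx; split; [apply fpos, hx|].
  apply (mono b); auto; try lra; intros y hy; apply fpos; lra.
Qed.

(** At a positive critical point [f'' / f = 2 eta / x - 1], and [x > 2 eta]: trivially
    if [eta <= 0], and by [no_oscillation] otherwise. *)
Lemma critical_point_pos (x : R) : 0 < x -> f1 x = 0 -> f2 x * f x < 0.
Proof.
  intros hx f1x.
  assert (fx : f x <> 0) by (intros fx; apply (simple_zeros_pos x); auto).
  assert (hlt : 2 * eta < x).
  { destruct (Rlt_le_dec (2 * eta) x) as [H|H]; [exact H|exfalso].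
    destruct (no_oscillation x hx H x); lra. }
  pose proof (ho x) as ox; rewrite f1x in ox.
  assert (P : 0 < f x * f x) by nra.
  assert (x * (f2 x * f x) < 0); [|nra].
  replace (x * (f2 x * f x)) with (- (x - 2 * eta) * (f x * f x)); nra.
Qed.

Lemma critical_point_0 : f1 0 = 0 -> f2 0 * f 0 < 0.
Proof.
  intros f10.
  pose proof (cs_ode0 _ _ _ _ _ hf) as o0.
  rewrite f10 in o0; rewrite h0 in o0 |- *; nra.
Qed.

Local Notation g := (reduced_derivative L f f1).
Local Notation dg := (reduced_derivative2 L f1 f2).

Lemma is_derive_reduced (x : R) : is_derive g x (dg x).
Proof.
  unfold reduced_derivative, reduced_derivative2; auto_derive.
  - repeat split; [exists (f1 x); apply h1 | exists (f2 x); apply h2].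
  - erewrite !is_derive_unique by (apply h1 || apply h2); ring.
Qed.

Lemma reduced_ode (x : R) :
  x * dg x + L * g x = - (x * x - 2 * eta * x - L * (L + 1)) * f x.
Proof.
  pose proof (ho x) as ox; unfold reduced_derivative, reduced_derivative2.
  replace (x * f2 x) with (- 2 * (L + 1) * f1 x - (x - 2 * eta) * f x) by lra; ring.
Qed.

(** In [F'' + (1 - 2 eta / x - L (L + 1) / x ^ 2) F = 0] the coefficient of [F] is positive
    at each positive zero of [F']. For [L >= 0] the positive points where it is nonpositive
    form an interval starting at the origin. For [L < 0] it can be nonpositive only between
    its two roots, which for [eta > 0] are positive and below [2 eta]. *)
Lemma turning_point_lt_zero (x : R) :
  0 < x -> g x = 0 -> 0 < x * x - 2 * eta * x - L * (L + 1).
Proof.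
  intros hx gx.
  destruct (Rlt_le_dec 0 (x * x - 2 * eta * x - L * (L + 1))) as [H|H]; [exact H|exfalso].
  destruct (Rle_lt_dec 0 L) as [hL0|hL0].
  - assert (q : forall y, 0 <= y <= x -> y * y - 2 * eta * y - L * (L + 1) <= 0).
    { intros y hy.
      (* convexity, the quadratic being nonpositive at both ends *)
      assert (x * (y * y - 2 * eta * y - L * (L + 1)) <= 0); [|nra].
      assert (0 <= L * (L + 1)) by nra.
      replace (x * (y * y - 2 * eta * y - L * (L + 1)))
        with (y * (x * x - 2 * eta * x - L * (L + 1)) - y * x * (x - y)
              - (x - y) * (L * (L + 1))) by ring.
      assert (0 <= y * x * (x - y)) by (apply Rmult_le_pos; nra).
      nra. }
    assert (g0 : 0 < g 0) by (unfold reduced_derivative; rewrite h0; lra).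
    assert (gpos : forall c, 0 < c <= x -> (forall y, 0 < y <= c -> 0 <= f y) -> 0 < g c).
    { intros c hc fpos.
      apply (weighted_pos_of_pos_at_0 g dg L c); auto; try lra.
      { apply is_derive_reduced. }
      intros y hy; rewrite reduced_ode.
      pose proof (q y ltac:(lra)); pose proof (fpos y hy); nra. }
    assert (fpos : forall y, 0 < y <= x -> 0 < f y).
    { intros y hy.
      destruct (Rlt_le_dec 0 (f y)) as [Hf|Hf]; [exact Hf|exfalso].
      destruct (first_zero f 0 y) as [s [hs [fs spos]]]; try lra.
      { apply (continuity_pt_of_derive f f1 h1). }
      assert (gs : 0 < g s).
      { apply gpos; [lra|]; intros z hz.
        destruct (Req_dec z s) as [->|ne]; [lra|]; apply Rlt_le, spos; lra. }
      unfold reduced_derivative in gs; rewrite fs in gs.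
      (* [f] reaches the zero [s] from above, hence cannot increase there *)
      destruct (is_derive_neg_sign_change (fun x => - f x) s (- f1 s))
        as [r [hr Hr]]; try lra.
      { exact (is_derive_opp f s (f1 s) (h1 s)). }
      { nra. }
      assert (0 < Rmin r s) by (apply Rmin_pos; lra).
      pose proof (Rmin_l r s); pose proof (Rmin_r r s).
      destruct (Hr (s - Rmin r s / 2)) as [M _].
      { rewrite Rabs_left; lra. }
      specialize (M ltac:(lra)); specialize (spos (s - Rmin r s / 2)); lra. }
    assert (0 < g x) by (apply gpos; [lra|]; intros; apply Rlt_le, fpos; lra).
    lra.
  - assert (x <= 2 * eta).
    { assert (0 < - L * (L + 1)) by nra.
      destruct (Rle_lt_dec x (2 * eta)); [assumption|nra]. }
    destruct (no_oscillation x hx ltac:(assumption) x) as [P1 P2]; [lra|].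
    unfold reduced_derivative in gx; nra.
Qed.

Lemma reduced_zero_pos (x : R) : 0 < x -> g x = 0 -> dg x * f x < 0.
Proof.
  intros hx gx.
  assert (fx : f x <> 0).
  { intros fx; apply (simple_zeros_pos x hx fx).
    unfold reduced_derivative in gx; rewrite fx in gx; nra. }
  pose proof (turning_point_lt_zero x hx gx) as T.
  pose proof (reduced_ode x) as ox; rewrite gx in ox.
  assert (P : 0 < f x * f x) by nra.
  assert (x * (dg x * f x) < 0); [|nra].
  replace (x * (dg x * f x))
    with (- (x * x - 2 * eta * x - L * (L + 1)) * (f x * f x)); nra.
Qed.

End HalfLine.

(** * Interlacing for the Coulomb equation *)

Lemma simple_zeros (L eta : R) (f f1 f2 : R -> R) (x : R) :
  -1 < L -> coulomb_solution L eta f f1 f2 -> f x = 0 -> f1 x <> 0.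
Proof.
  intros hL hf fx f1x.
  destruct (Rtotal_order x 0) as [H|[H|H]].
  - apply (simple_zeros_pos _ _ _ _ _ hL (coulomb_solution_reflect _ _ _ _ _ hf) (- x));
      rewrite ?Ropp_involutive; lra.
  - subst x; rewrite (cs_init _ _ _ _ _ hf) in fx; lra.
  - now apply (simple_zeros_pos _ _ _ _ _ hL hf x).
Qed.

Lemma interlacing_solution_derivative (L eta : R) (f f1 f2 : R -> R) :
  -1 < L -> coulomb_solution L eta f f1 f2 -> interlacing_zeros (fun _ => True) f f1.
Proof.
  intros hL hf.
  apply (interlacing_of_crossings _ f f1 f1 f2); auto.
  - apply (cs_der1 _ _ _ _ _ hf).
  - apply (cs_der2 _ _ _ _ _ hf).
  - intros x _ fx; pose proof (simple_zeros _ _ _ _ _ x hL hf fx); nra.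
  - intros x _ f1x.
    destruct (Rtotal_order x 0) as [H|[H|H]].
    + pose proof (critical_point_pos _ _ _ _ _ hL
                    (coulomb_solution_reflect _ _ _ _ _ hf) (- x)) as P.
      cbv beta in P; rewrite Ropp_involutive in P; apply P; lra.
    + subst x; now apply (critical_point_0 _ _ _ _ _ hL hf).
    + now apply (critical_point_pos _ _ _ _ _ hL hf).
Qed.

Lemma interlacing_solution_reduced_derivative_pos (L eta : R) (f f1 f2 : R -> R) :
  -1 < L -> coulomb_solution L eta f f1 f2 ->
  interlacing_zeros (fun x => 0 < x) f (reduced_derivative L f f1).
Proof.
  intros hL hf.
  apply (interlacing_of_crossings _ f _ f1 (reduced_derivative2 L f1 f2)).
  - intros; lra.
  - apply (cs_der1 _ _ _ _ _ hf).
  - apply (is_derive_reduced _ _ _ _ _ hf).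
  - intros x hx fx; pose proof (simple_zeros _ _ _ _ _ x hL hf fx).
    assert (0 < f1 x * f1 x) by nra.
    unfold reduced_derivative; rewrite fx; nra.
  - apply (reduced_zero_pos _ _ _ _ _ hL hf).
Qed.

Lemma interlacing_solution_reduced_derivative_neg (L eta : R) (f f1 f2 : R -> R) :
  -1 < L -> coulomb_solution L eta f f1 f2 ->
  interlacing_zeros (fun x => x < 0) f (reduced_derivative L f f1).
Proof.
  intros hL hf.
  pose proof (coulomb_solution_reflect _ _ _ _ _ hf) as hr.
  assert (H : interlacing_zeros (fun x => x < 0) f
                (fun x => - reduced_derivative L f f1 x)).
  { (* on the negative axis it is [- g] that makes [(f, - g)] turn clockwise *)
    apply (interlacing_of_crossings _ f _ f1 (fun x => - reduced_derivative2 L f1 f2 x)).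
    - intros; lra.
    - apply (cs_der1 _ _ _ _ _ hf).
    - intros x; exact (is_derive_opp _ _ _ (is_derive_reduced _ _ _ _ _ hf x)).
    - intros x hx fx; pose proof (simple_zeros _ _ _ _ _ x hL hf fx).
      assert (0 < f1 x * f1 x) by nra.
      unfold reduced_derivative; rewrite fx; nra.
    - intros x hx gx.
      pose proof (reduced_zero_pos _ _ _ _ _ hL hr (- x)) as P.
      unfold reduced_derivative, reduced_derivative2 in *; rewrite Ropp_involutive in P.
      lra. }
  (* [g] and [- g] have the same zeros *)
  destruct H as [H1 H2]; split; intros a b hab.
  - destruct (H1 a b hab) as [s [[hs [Ds vs]] huniq]].
    exists s; split; [split; [exact hs|]; split; [exact Ds | lra]|].
    intros t [ht [Dt vt]]; apply huniq; split; [exact ht|]; split; [exact Dt | lra].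
  - apply H2.
    destruct hab as [hab [[Da ga] [[Db gb] hno]]].
    split; [exact hab|]; split; [split; lra|]; split; [split; lra|].
    intros x hx [Dx gx]; apply (hno x hx); split; [exact Dx | lra].
Qed.

(** * Power series of the Coulomb function *)

(** Taylor coefficients at the origin of [rho |-> 1F1(L + 1 - i eta, 2 L + 2, 2 i rho)]. *)
Definition kummer_coef (L eta : R) (n : nat) : C :=
  (Cpochhammer (RtoC (L + 1) - Ci * RtoC eta) n / Cpochhammer (RtoC (2 * L + 2)) n
   * ((RtoC 2 * Ci) ^ n / RtoC (INR (fact n))))%C.

Definition kummer_re (L eta : R) (n : nat) : R := Re (kummer_coef L eta n).
Definition kummer_im (L eta : R) (n : nat) : R := Im (kummer_coef L eta n).

Lemma Cpochhammer_neq_0 (b : R) (n : nat) : 0 < b -> Cpochhammer (RtoC b) n <> RtoC 0.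
Proof.
  intros hb; induction n as [|n IH]; simpl.
  - intros e; apply RtoC_inj in e; lra.
  - apply Cmult_neq_0; [exact IH|].
    rewrite <- RtoC_plus; intros e; apply RtoC_inj in e.
    pose proof (pos_INR n); lra.
Qed.

Lemma kummer_coef_0 (L eta : R) : kummer_coef L eta 0 = RtoC 1.
Proof.
  unfold kummer_coef; simpl; field.
Qed.

Lemma kummer_coef_S (L eta : R) (n : nat) : -1 < L ->
  (RtoC (INR (S n) * (INR n + 2 * L + 2)) * kummer_coef L eta (S n))%C =
  ((RtoC (2 * eta) + RtoC (2 * (INR n + L + 1)) * Ci) * kummer_coef L eta n)%C.
Proof.
  intros hL; unfold kummer_coef.
  pose proof (pos_INR n).
  assert (hP := Cpochhammer_neq_0 (2 * L + 2) n ltac:(lra)).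
  assert (hF : RtoC (INR (fact n)) <> RtoC 0).
  { intros e; apply RtoC_inj in e; apply (INR_fact_neq_0 n e). }
  assert (hS : RtoC (INR (S n)) <> RtoC 0).
  { intros e; apply RtoC_inj in e; rewrite S_INR in e; lra. }
  assert (hB : (RtoC (2 * L + 2) + RtoC (INR n))%C <> RtoC 0).
  { rewrite <- RtoC_plus; intros e; apply RtoC_inj in e; lra. }
  replace (fact (S n)) with (S n * fact n)%nat by reflexivity.
  rewrite mult_INR, !RtoC_mult, Cpow_S.
  change (Cpochhammer (RtoC (2 * L + 2)) (S n))
    with (Cpochhammer (RtoC (2 * L + 2)) n * (RtoC (2 * L + 2) + RtoC (INR n)))%C.
  change (Cpochhammer (RtoC (L + 1) - Ci * RtoC eta) (S n))
    with (Cpochhammer (RtoC (L + 1) - Ci * RtoC eta) n *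
          (RtoC (L + 1) - Ci * RtoC eta + RtoC (INR n)))%C.
  set (P := Cpochhammer (RtoC (2 * L + 2)) n) in *.
  set (Q := Cpochhammer _ n).
  set (Bn := (RtoC (2 * L + 2) + RtoC (INR n))%C) in *.
  replace (RtoC (INR n + 2 * L + 2)) with Bn
    by (unfold Bn; rewrite <- RtoC_plus; f_equal; ring).
  replace (RtoC 2 * RtoC eta + RtoC 2 * RtoC (INR n + L + 1) * Ci)%C
    with (RtoC 2 * Ci * (RtoC (L + 1) - Ci * RtoC eta + RtoC (INR n)))%C.
  - field; repeat split; assumption.
  - apply injective_projections; simpl; ring.
Qed.

Lemma kummer_re_S (L eta : R) (n : nat) : -1 < L ->
  INR (S n) * (INR n + 2 * L + 2) * kummer_re L eta (S n) =
  2 * eta * kummer_re L eta n - 2 * (INR n + L + 1) * kummer_im L eta n.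
Proof.
  intros hL; pose proof (f_equal Re (kummer_coef_S L eta n hL)) as e.
  unfold kummer_re, kummer_im.
  rewrite re_scal_l in e; rewrite e, re_mult; simpl; ring.
Qed.

Lemma kummer_im_S (L eta : R) (n : nat) : -1 < L ->
  INR (S n) * (INR n + 2 * L + 2) * kummer_im L eta (S n) =
  2 * eta * kummer_im L eta n + 2 * (INR n + L + 1) * kummer_re L eta n.
Proof.
  intros hL; pose proof (f_equal Im (kummer_coef_S L eta n hL)) as e.
  unfold kummer_re, kummer_im.
  rewrite im_scal_l in e; rewrite e, im_mult; simpl; ring.
Qed.

Lemma kummer_coef_bound (L eta : R) (n : nat) : -1 < L ->
  Rabs (kummer_re L eta n) + Rabs (kummer_im L eta n)
  <= (2 + Rabs eta / (L + 1)) ^ n / INR (fact n).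
Proof.
  intros hL; induction n as [|n IH].
  - unfold kummer_re, kummer_im; rewrite kummer_coef_0; simpl.
    rewrite Rabs_R0, Rabs_R1; lra.
  - pose proof (pos_INR n) as hn; pose proof (Rabs_pos eta) as he.
    set (s := Rabs (kummer_re L eta n) + Rabs (kummer_im L eta n)) in *.
    set (K := 2 + Rabs eta / (L + 1)) in *.
    assert (hs : 0 <= s).
    { pose proof (Rabs_pos (kummer_re L eta n)); pose proof (Rabs_pos (kummer_im L eta n)).
      unfold s; lra. }
    assert (hS : 0 < INR (S n)) by (rewrite S_INR; lra).
    assert (hb : 0 < INR n + 2 * L + 2) by lra.
    assert (hp : 0 < INR (S n) * (INR n + 2 * L + 2)) by (apply Rmult_lt_0_compat; lra).
    assert (step : INR (S n) * (INR n + 2 * L + 2) *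
              (Rabs (kummer_re L eta (S n)) + Rabs (kummer_im L eta (S n)))
            <= (2 * Rabs eta + 2 * (INR n + L + 1)) * s).
    { rewrite Rmult_plus_distr_l.
      rewrite <- (Rabs_pos_eq (INR (S n) * (INR n + 2 * L + 2))) by lra.
      rewrite <- !Rabs_mult, kummer_re_S, kummer_im_S by assumption.
      set (p := kummer_re L eta n) in *; set (q := kummer_im L eta n) in *.
      set (c := 2 * (INR n + L + 1)).
      assert (hc : 0 <= c) by (unfold c; lra).
      pose proof (Rabs_triang (2 * eta * p) (- (c * q))) as T1.
      pose proof (Rabs_triang (2 * eta * q) (c * p)) as T2.
      rewrite Rabs_Ropp, !Rabs_mult, (Rabs_pos_eq 2), (Rabs_pos_eq c) in T1 by lra.
      rewrite !Rabs_mult, (Rabs_pos_eq 2), (Rabs_pos_eq c) in T2 by lra.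
      unfold Rminus; unfold s; lra. }
    assert (hK : 2 * Rabs eta + 2 * (INR n + L + 1) <= K * (INR n + 2 * L + 2)).
    { assert (0 <= Rabs eta / (L + 1)) by (apply Rdiv_le_0_compat; lra).
      replace (K * (INR n + 2 * L + 2))
        with (2 * (INR n + 2 * L + 2) + Rabs eta / (L + 1) * INR n + 2 * Rabs eta)
        by (unfold K; field; lra).
      nra. }
    change (fact (S n)) with (S n * fact n)%nat; rewrite mult_INR, <- tech_pow_Rmult.
    pose proof (INR_fact_lt_0 n) as hF.
    apply (Rmult_le_reg_l (INR (S n) * (INR n + 2 * L + 2))); [exact hp|].
    replace (INR (S n) * (INR n + 2 * L + 2) * (K * K ^ n / (INR (S n) * INR (fact n))))
      with (K * (INR n + 2 * L + 2) * (K ^ n / INR (fact n))) by (field; lra).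
    apply (Rle_trans _ _ _ step).
    apply Rmult_le_compat; try assumption; lra.
Qed.

Lemma CV_radius_of_exp_bound (a : nat -> R) (K : R) :
  (forall n, Rabs (a n) <= K ^ n / INR (fact n)) -> CV_radius a = p_infty.
Proof.
  intros ha.
  destruct (CV_radius_bounded a) as [hub _].
  assert (H : forall r : R, Rbar_le r (CV_radius a)).
  { intros r; apply hub.
    assert (hc : ex_series (fun n => (K * Rabs r) ^ n / INR (fact n))).
    { exists (exp (K * Rabs r)).
      apply is_series_ext with (2 := is_exp_Reals (K * Rabs r)).
      intros n; rewrite pow_n_pow; reflexivity. }
    destruct (filterlim_bounded _ (ex_intro _ 0 (ex_series_lim_0 _ hc))) as [M hM].
    exists M; intros n.
    apply Rle_trans with (2 := hM n).
    apply Rle_trans with (2 := Rle_abs _).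
    rewrite Rabs_mult, <- RPow_abs, Rpow_mult_distr.
    replace (K ^ n * Rabs r ^ n / INR (fact n))
      with (K ^ n / INR (fact n) * Rabs r ^ n) by (unfold Rdiv; ring).
    apply Rmult_le_compat_r; [apply pow_le, Rabs_pos | apply ha]. }
  destruct (CV_radius a) as [c| |]; [exfalso|reflexivity|exfalso].
  - specialize (H (c + 1)); simpl in H; lra.
  - exact (H 0).
Qed.

Lemma CV_radius_kummer_re (L eta : R) : -1 < L -> CV_radius (kummer_re L eta) = p_infty.
Proof.
  intros hL; apply CV_radius_of_exp_bound with (2 + Rabs eta / (L + 1)); intros n.
  pose proof (kummer_coef_bound L eta n hL); pose proof (Rabs_pos (kummer_im L eta n)).
  lra.
Qed.

Lemma CV_radius_kummer_im (L eta : R) : -1 < L -> CV_radius (kummer_im L eta) = p_infty.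
Proof.
  intros hL; apply CV_radius_of_exp_bound with (2 + Rabs eta / (L + 1)); intros n.
  pose proof (kummer_coef_bound L eta n hL); pose proof (Rabs_pos (kummer_re L eta n)).
  lra.
Qed.

Lemma kummer_term (L eta rho : R) (n : nat) :
  (Cpochhammer (RtoC (L + 1) - Ci * RtoC eta) n / Cpochhammer (RtoC (2 * L + 2)) n
   * ((RtoC 2 * Ci * RtoC rho) ^ n / RtoC (INR (fact n))))%C
  = (kummer_coef L eta n * RtoC (rho ^ n))%C.
Proof.
  unfold kummer_coef, Cdiv; rewrite Cpow_mult_l, RtoC_pow; ring.
Qed.

Lemma coulomb_PSeries (L eta rho : R) :
  coulomb L eta rho =
  cos rho * PSeries (kummer_re L eta) rho + sin rho * PSeries (kummer_im L eta) rho.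
Proof.
  unfold coulomb, coulombC, kummer_1F1, CSeries.
  rewrite (Series_ext _ (fun n => kummer_re L eta n * rho ^ n))
    by (intros n; rewrite kummer_term, re_scal_r; reflexivity).
  rewrite (Series_ext (fun n => Im _) (fun n => kummer_im L eta n * rho ^ n))
    by (intros n; rewrite kummer_term, im_scal_r; reflexivity).
  fold (PSeries (kummer_re L eta) rho); fold (PSeries (kummer_im L eta) rho).
  unfold Cexp; rewrite re_mult; simpl.
  replace (- (0 * rho - 1 * 0)) with 0 by ring.
  replace (- (0 * 0 + 1 * rho)) with (- rho) by ring.
  rewrite exp_0, cos_neg, sin_neg; ring.
Qed.

(** Termwise form of [x A'' + k A' = e A - 2 x B' - m B] for entire power series. *)
Lemma PSeries_second_order (a b : nat -> R) (k e m x : R) :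
  CV_radius a = p_infty -> CV_radius b = p_infty ->
  (forall n, INR (S n) * (INR n + k) * a (S n) = e * a n - (2 * INR n + m) * b n) ->
  x * PSeries (PS_derive (PS_derive a)) x + k * PSeries (PS_derive a) x =
  e * PSeries a x - 2 * (x * PSeries (PS_derive b) x) - m * PSeries b x.
Proof.
  intros ha hb rec.
  assert (conv : forall c, CV_radius c = p_infty -> ex_pseries c x).
  { intros c hc; apply CV_radius_inside; rewrite hc; exact I. }
  assert (ha1 : CV_radius (PS_derive a) = p_infty) by now rewrite CV_radius_derive.
  assert (ha2 : CV_radius (PS_derive (PS_derive a)) = p_infty)
    by now rewrite CV_radius_derive.
  assert (hb1 : CV_radius (PS_derive b) = p_infty) by now rewrite CV_radius_derive.
  rewrite <- !PSeries_incr_1, <- !PSeries_scal.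
  assert (ex1 : ex_pseries (PS_incr_1 (PS_derive (PS_derive a))) x)
    by (apply conv; now rewrite CV_radius_incr_1).
  assert (ex2 : ex_pseries (PS_incr_1 (PS_derive b)) x)
    by (apply conv; now rewrite CV_radius_incr_1).
  assert (exs : forall (c : R) (d : nat -> R),
            ex_pseries d x -> ex_pseries (PS_scal c d) x).
  { intros c d hd; apply ex_pseries_scal; [apply Rmult_comm | exact hd]. }
  rewrite <- PSeries_plus by auto.
  rewrite <- !PSeries_minus; auto.
  2:{ apply ex_pseries_minus; auto. }
  apply PSeries_ext; intros n.
  pose proof (rec n) as rn.
  unfold PS_minus, PS_plus, PS_opp, PS_scal, PS_incr_1, PS_derive.
  destruct n as [|n]; unfold plus, minus, opp, scal, zero; cbn -[INR];
    unfold mult; cbn -[INR]; rewrite ?S_INR in *; change (INR 0) with 0 in *; lra.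
Qed.

(** The system satisfied by the real and imaginary parts [A], [B] of the Kummer function on
    the imaginary axis turns into the Coulomb equation for [cos x A + sin x B]. *)
Lemma coulomb_solution_of_system (L eta : R) (A A1 A2 B B1 B2 : R -> R) :
  -1 < L ->
  (forall x, is_derive A x (A1 x)) -> (forall x, is_derive A1 x (A2 x)) ->
  (forall x, is_derive B x (B1 x)) -> (forall x, is_derive B1 x (B2 x)) ->
  (forall x, x * A2 x + (2 * L + 2) * A1 x
             = 2 * eta * A x - 2 * (x * B1 x) - (2 * L + 2) * B x) ->
  (forall x, x * B2 x + (2 * L + 2) * B1 x
             = 2 * eta * B x + 2 * (x * A1 x) + (2 * L + 2) * A x) ->
  A 0 = 1 -> B 0 = 0 ->
  (2 * L + 3) * A2 0 = 2 * eta * A1 0 - 2 * (L + 2) * B1 0 ->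
  coulomb_solution L eta
    (fun x => cos x * A x + sin x * B x)
    (fun x => - sin x * A x + cos x * B x + cos x * A1 x + sin x * B1 x)
    (fun x => - (cos x * A x + sin x * B x) + 2 * (- sin x * A1 x + cos x * B1 x)
              + cos x * A2 x + sin x * B2 x).
Proof.
  intros hL dA dA1 dB dB1 oA oB A0 B0 A20.
  assert (DA : forall x, Derive (fun t => A t) x = A1 x)
    by (intros x; apply is_derive_unique, dA).
  assert (DA1 : forall x, Derive (fun t => A1 t) x = A2 x)
    by (intros x; apply is_derive_unique, dA1).
  assert (DB : forall x, Derive (fun t => B t) x = B1 x)
    by (intros x; apply is_derive_unique, dB).
  assert (DB1 : forall x, Derive (fun t => B1 t) x = B2 x)
    by (intros x; apply is_derive_unique, dB1).
  split.
  - intros x; auto_derive.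
    + repeat split; [exists (A1 x); apply dA | exists (B1 x); apply dB].
    + rewrite DA, DB; ring.
  - intros x; auto_derive.
    + repeat split;
        [ exists (A1 x); apply dA | exists (B1 x); apply dB
        | exists (A2 x); apply dA1 | exists (B2 x); apply dB1 ].
    + rewrite DA, DB, DA1, DB1; ring.
  - rewrite cos_0, sin_0; lra.
  - intros x; specialize (oA x); specialize (oB x).
    replace (x * (- (cos x * A x + sin x * B x) + 2 * (- sin x * A1 x + cos x * B1 x)
                  + cos x * A2 x + sin x * B2 x))
      with (- x * (cos x * A x + sin x * B x) + 2 * x * (- sin x * A1 x + cos x * B1 x)
            + cos x * (x * A2 x) + sin x * (x * B2 x)) by ring.
    replace (x * A2 x) with (2 * eta * A x - 2 * (x * B1 x) - (2 * L + 2) * B x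
                             - (2 * L + 2) * A1 x) by lra.
    replace (x * B2 x) with (2 * eta * B x + 2 * (x * A1 x) + (2 * L + 2) * A x
                             - (2 * L + 2) * B1 x) by lra.
    ring.
  - assert (B10 : B1 0 = 1).
    { specialize (oB 0); rewrite A0, B0 in oB.
      apply (Rmult_eq_reg_l (2 * L + 2)); lra. }
    rewrite A0, B0, B10, cos_0, sin_0 in *; lra.
Qed.

Lemma coulomb_is_solution (L eta : R) : -1 < L ->
  exists f1 f2, coulomb_solution L eta (coulomb L eta) f1 f2.
Proof.
  intros hL.
  pose proof (CV_radius_kummer_re L eta hL) as ra.
  pose proof (CV_radius_kummer_im L eta hL) as rb.
  set (a := kummer_re L eta) in *; set (b := kummer_im L eta) in *.
  assert (der : forall c x, CV_radius c = p_infty ->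
            is_derive (PSeries c) x (PSeries (PS_derive c) x)).
  { intros c x hc; apply is_derive_PSeries; rewrite hc; exact I. }
  replace (coulomb L eta) with (fun x => cos x * PSeries a x + sin x * PSeries b x)
    by (apply functional_extensionality; intros x; symmetry; apply coulomb_PSeries).
  do 2 eexists.
  apply (coulomb_solution_of_system L eta
           (PSeries a) (PSeries (PS_derive a)) (PSeries (PS_derive (PS_derive a)))
           (PSeries b) (PSeries (PS_derive b)) (PSeries (PS_derive (PS_derive b))) hL).
  - intros x; apply der, ra.
  - intros x; apply der; now rewrite CV_radius_derive.
  - intros x; apply der, rb.
  - intros x; apply der; now rewrite CV_radius_derive.
  - intros x; apply PSeries_second_order; auto; intros n.
    pose proof (kummer_re_S L eta n hL) as r; fold a b in r; lra.
  - (* the same system is satisfied by the pair [(B, - A)] *)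
    intros x.
    assert (rna : CV_radius (PS_opp a) = p_infty) by now rewrite CV_radius_opp.
    pose proof (PSeries_second_order b (PS_opp a) (2 * L + 2) (2 * eta) (2 * L + 2) x
                  rb rna) as H.
    assert (e1 : PSeries (PS_derive (PS_opp a)) x = - PSeries (PS_derive a) x).
    { rewrite <- PSeries_opp; apply PSeries_ext; intros n.
      unfold PS_derive, PS_opp, opp; cbn -[INR]; ring. }
    rewrite e1, PSeries_opp in H.
    rewrite H; [ring|]; intros n.
    pose proof (kummer_im_S L eta n hL) as r; fold a b in r.
    change (PS_opp a n) with (- a n); lra.
  - rewrite PSeries_0; unfold a, kummer_re; now rewrite kummer_coef_0.
  - rewrite PSeries_0; unfold b, kummer_im; now rewrite kummer_coef_0.
  - rewrite !PSeries_0; unfold PS_derive.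
    pose proof (kummer_re_S L eta 1 hL) as r; fold a b in r.
    simpl INR in *; lra.
Qed.

(** * Interlacing for the Coulomb functions *)

Lemma interlacing_zeros_ext (D : R -> Prop) (f g h : R -> R) :
  (forall x, g x = h x) -> interlacing_zeros D f g -> interlacing_zeros D f h.
Proof.
  intros e; replace h with g; [auto|].
  now apply functional_extensionality.
Qed.

Theorem theorem5 :
  (forall L eta : R, - (1 / 2) < L ->
     interlacing_zeros (fun rho => 0 < rho) (coulomb_F L eta) (coulomb_dF L eta) /\
     interlacing_zeros (fun rho => rho < 0) (coulomb_F L eta) (coulomb_dF L eta)) /\
  (forall L eta : R, - 1 < L ->
     interlacing_zeros (fun _ => True) (coulomb_F L eta) (coulomb_rdF L eta)).
Proof.
  split; intros L eta hL.
  - assert (hL1 : -1 < L) by lra.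
    destruct (coulomb_is_solution L eta hL1) as [f1 [f2 hf]].
    assert (e : forall x, (L + 1) * coulomb L eta x + x * f1 x = coulomb_dF L eta x).
    { intros x; unfold coulomb_dF.
      now rewrite (is_derive_unique _ _ _ (cs_der1 _ _ _ _ _ hf x)). }
    split; apply (interlacing_zeros_ext _ _ _ _ e).
    + now apply interlacing_solution_reduced_derivative_pos with eta f2.
    + now apply interlacing_solution_reduced_derivative_neg with eta f2.
  - destruct (coulomb_is_solution L eta hL) as [f1 [f2 hf]].
    apply interlacing_zeros_ext with f1.
    + intros x; symmetry; apply is_derive_unique, (cs_der1 _ _ _ _ _ hf).
    + now apply interlacing_solution_derivative with L eta f2.
Qed.
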